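(* Let $n\geq 3$, let $G=\langle x,y:~x^n=y^2=e,~yxy=x^{-1}\rangle$ be the dihedral group of order $2n$, and let $A=\langle x\rangle$. (1) If $D\subseteq A$ is a difference set in $A$ with parameters $\left(n,\frac{2n-1-\sqrt{8n-7}}{2},n+1-\sqrt{8n-7}\right)$, then $\Gamma(D)=\mathrm{Cay}(G,A^\#\cup yD)$ is a strictly Deza dihedrant of WL-rank $4$. (2) For every integer $m\geq 2$ which is not divisible by $4$, the graph $K_4\times K_m$ is a strictly Deza dihedrant of WL-rank $4$.
   Context: All graphs are finite, undirected, without loops and multiple edges. For a finite group $G$ with identity $e$, $G^\#=G\setminus\{e\}$. For $S\subseteq G$ with $e\notin S$ and $S=S^{-1}$, the Cayley graph $\mathrm{Cay}(G,S)$ has vertex set $G$ and edges $\{g,sg\}$ for $g\in G$, $s\in S$. A dihedrant is a graph isomorphic to a Cayley graph over a dihedral group (of order $2n$, $n\geq 3$). A subset $D$ of a group $H$ is a difference set with parameters $(v,k,\lambda)$ if $|H|=v$, $|D|=k$, $\lambda$ is a positive integer, and every element of $H^\#$ can be written as $d_1^{-1}d_2$ with $d_1,d_2\in D$ in exactly $\lambda$ ways. A $k$-regular graph on $n$ vertices is a Deza graph with parameters $(n,k,b,a)$ if every pair of distinct vertices has either $a$ or $b$ common neighbours. A graph is strongly regular if it is $k$-regular and there are $\lambda,\mu$ such that adjacent vertices have $\lambda$ common neighbours and distinct nonadjacent vertices have $\mu$ common neighbours. A strictly Deza graph is a Deza graph which is not strongly regular and has diameter $2$. The WL-closure of a graph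 $\Gamma=(V,E)$ is the smallest coherent configuration on $V$ such that $E$ is a union of its classes; the WL-rank of $\Gamma$ is the number of classes of this coherent configuration. For a Cayley graph $\mathrm{Cay}(G,S)$ this coincides with the rank (number of basic sets) of the smallest S-ring over $G$ in which $S$ is a union of basic sets. $K_n$ is the complete graph on $n$ vertices and $\Gamma_1\times\Gamma_2$ is the Cartesian product: vertex set $V_1\times V_2$, with $(v_1,v_2)\sim(u_1,u_2)$ iff ($v_1=u_1$ and $v_2\sim u_2$) or ($v_2=u_2$ and $v_1\sim u_1$). *)

(* Defs.v *)
From mathcomp Require Import all_boot all_fingroup all_solvable.

Set Implicit Arguments.
Unset Strict Implicit.
Unset Printing Implicit Defensive.

Local Open Scope group_scope.

Section Graphs.

Variables (T : finType) (e : rel T).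

Definition simple_graph : Prop := symmetric e /\ irreflexive e.

Definition regular_graph (k : nat) : Prop := forall x : T, #|[set y | e x y]| = k.

Definition common_nbrs (x y : T) : nat := #|[set z | e x z && e y z]|.

Definition deza (n k b a : nat) : Prop :=
  [/\ simple_graph, #|T| = n, regular_graph k &
      forall x y : T, x != y -> common_nbrs x y = a \/ common_nbrs x y = b].

(* No side condition excludes complete or empty graphs. *)
Definition strongly_regular : Prop :=
  simple_graph /\
  exists k l m : nat,
    [/\ regular_graph k,
        forall x y : T, e x y -> common_nbrs x y = l &
        forall x y : T, x != y -> ~~ e x y -> common_nbrs x y = m].

Definition is_dist (x y : T) (d : nat) : Prop :=
  (exists p : seq T, [/\ path e x p, last x p = y & size p = d]) /\
  (forall p : seq T, path e x p -> last x p = y -> d <= size p).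

Definition has_diameter (d : nat) : Prop :=
  (forall x y : T, exists2 k, is_dist x y k & k <= d) /\
  (exists x y : T, is_dist x y d).

Definition strictly_deza : Prop :=
  [/\ exists n k b a : nat, deza n k b a, ~ strongly_regular & has_diameter 2].

End Graphs.

Definition graph_iso (T1 T2 : finType) (e1 : rel T1) (e2 : rel T2) : Prop :=
  exists2 f : T1 -> T2, bijective f & forall x y, e2 (f x) (f y) = e1 x y.

(* The neighbours of g are the elements s * g with s in S. *)
Definition cayley (gT : finGroupType) (S : {set gT}) : rel gT :=
  fun g h => h \in S :* g.

Definition connection_set (gT : finGroupType) (S : {set gT}) : Prop :=
  1 \notin S /\ S = S^-1.

Definition is_dihedral (n : nat) (gT : finGroupType) : Prop :=
  [set: gT] \isog Grp (x : y : x ^+ n, y ^+ 2, y * x * y = x^-1).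

(* Generators satisfying the relations of a group isomorphic to the presented
   (finite) one induce a surjection between groups of equal order, so they are
   the images of the formal generators under an isomorphism. *)
Definition dihedral_presentation
    (n : nat) (gT : finGroupType) (x y : gT) : Prop :=
  [/\ is_dihedral n gT, <<[set x; y]>> = [set: gT] &
      [/\ x ^+ n = 1, y ^+ 2 = 1 & y * x * y = x^-1]].

Definition dihedrant (T : finType) (e : rel T) : Prop :=
  exists (n : nat) (gT : finGroupType) (S : {set gT}),
    [/\ 3 <= n, is_dihedral n gT, connection_set S & graph_iso e (cayley S)].

Definition difference_set
    (gT : finGroupType) (H : {group gT}) (D : {set gT}) (v k l : nat) : Prop :=
  [/\ D \subset H, #|H| = v, #|D| = k, 0 < l &
      forall h, h \in H^# ->
        #|[set d : gT * gT | [&& d.1 \in D, d.2 \in D & h == d.1^-1 * d.2]]| = l].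

Section WeisfeilerLeman.

Variable T : finType.

Definition union_of_classes (P : {set {set T * T}}) (X : {set T * T}) : Prop :=
  exists2 Q : {set {set T * T}}, Q \subset P & X = cover Q.

Definition coherent_configuration (P : {set {set T * T}}) : Prop :=
  [/\ partition P [set: T * T],
      union_of_classes P [set u | u.1 == u.2],
      forall R, R \in P -> [set (u.2, u.1) | u in R] \in P &
      forall R1 R2 R3, R1 \in P -> R2 \in P -> R3 \in P ->
        exists c : nat, forall u, u \in R3 ->
          #|[set z | ((u.1, z) \in R1) && ((z, u.2) \in R2)]| = c].

(* "Smallest" means coarsest: every class of P is a union of classes of any
   other coherent configuration in which the edge set is a union of classes. *)
Definition is_WL_closure (e : rel T) (P : {set {set T * T}}) : Prop :=
  [/\ coherent_configuration P,
      union_of_classes P [set u | e u.1 u.2] &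
      forall Q, coherent_configuration Q ->
        union_of_classes Q [set u | e u.1 u.2] ->
        forall R, R \in P -> union_of_classes Q R].

Definition has_WL_rank (e : rel T) (r : nat) : Prop :=
  exists2 P, is_WL_closure e P & #|P| = r.

End WeisfeilerLeman.

Definition complete_graph (n : nat) : rel 'I_n := fun i j => i != j.

Definition cartesian_product (T1 T2 : finType) (e1 : rel T1) (e2 : rel T2) :
    rel (T1 * T2)%type :=
  fun v u => (v.1 == u.1) && e2 v.2 u.2 || (v.2 == u.2) && e1 v.1 u.1.

(* Main.v *)
(* In both families there is a symmetric colouring of the pairs of vertices by
   four colours for which the number of two-step walks with prescribed colours
   depends only on the colour of the end points, so the colour classes form a
   coherent configuration. Conversely, the colour of a pair is determined by
   equality, adjacency and the number of common neighbours, which every coherent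
   configuration refining the edge set must respect; hence the colour classes
   are the WL-closure.

   In (1), the graph consists of the two cosets of A, made complete, joined by
   the incidence graph of the symmetric design of D. The square roots only enter
   through the identity 2k + 2 = n + l and k < n: the identity makes the pairs
   inside a coset and the nonadjacent pairs across have the same number 2k of
   common neighbours, while adjacent pairs across have 2k - 2.

   In (2), an exact factorization G = HK with |H| = 4 and |K| = m presents
   K_4 x K_m as Cay(G, (H u K) \ 1), two vertices being adjacent when they share
   a coset of H or of K. For the dihedral group of order 4m, such a factorization
   comes from writing 2m as a product of coprime p and q and splitting <x> as
   <x^p><x^q>. *)

Require Import Defs.
From mathcomp Require Import all_boot all_order all_algebra.
From mathcomp Require Import all_fingroup all_solvable all_field.
From mathcomp Require Import zify ring.

Set Implicit Arguments.
Unset Strict Implicit.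
Unset Printing Implicit Defensive.

Import GRing.Theory Num.Theory.
Local Open Scope group_scope.

(** * Colourings and the WL-closure *)

Section CoherentConfigurations.

Variable T : finType.
Implicit Types (P Q : {set {set T * T}}) (X Y : {set T * T}).

(** The classes partition all pairs, so a set closed under sharing a class is the union of the
    classes it contains. *)
Lemma union_of_classesP P X : partition P [set: T * T] ->
  union_of_classes P X <->
  (forall R u v, R \in P -> u \in R -> v \in R -> u \in X -> v \in X).
Proof.
move=> partP; have tiP := partition_trivIset partP.
split=> [[Q /subsetP sQP ->] R u v PR Ru Rv /bigcupP[S QS Su] | closedX].
  apply/bigcupP; exists S => //.
  by rewrite -(def_pblock tiP (sQP S QS) Su) (def_pblock tiP PR Ru).
exists [set R in P | R \subset X]; first by apply/subsetP=> R /setIdP[].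
apply/setP=> u; apply/idP/bigcupP=> [Xu | [R /setIdP[_ /subsetP sRX] Ru]].
  have Pu : u \in cover P by rewrite (cover_partition partP) inE.
  have uu : u \in pblock P u by rewrite mem_pblock.
  exists (pblock P u) => //; rewrite inE pblock_mem //=.
  by apply/subsetP=> v /(closedX _ u v (pblock_mem Pu) uu); apply.
exact: sRX.
Qed.

Lemma mem_union_of_classes P X R u v : partition P [set: T * T] ->
  union_of_classes P X -> R \in P -> u \in R -> v \in R ->
  (u \in X) = (v \in X).
Proof.
move=> partP /(union_of_classesP _ partP) closedX PR Ru Rv.
by apply/idP/idP; apply: closedX PR _ _.
Qed.

(** The axiom concerns single classes; for unions the count of walks splits as a sum over pairs of
    classes. With the edge set of a symmetric [e] as [X] and [Y], it makes the number of common
    neighbours constant on each class. *)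
Lemma coherent_card_walks P X Y R u v :
  coherent_configuration P -> union_of_classes P X -> union_of_classes P Y ->
  R \in P -> u \in R -> v \in R ->
  #|[set z | ((u.1, z) \in X) && ((z, u.2) \in Y)]| =
  #|[set z | ((v.1, z) \in X) && ((z, v.2) \in Y)]|.
Proof.
case=> partP _ _ coefP [QX /subsetP sXP ->] [QY /subsetP sYP ->] PR Ru Rv.
(* By disjointness, the indicator of a union of classes is the sum of the indicators of its
   members. *)
have mem_cover (Q : {set {set T * T}}) w : {subset Q <= P} ->
  (w \in cover Q : nat) = \sum_(S in Q) (w \in S).
  move=> sQP; case: (boolP (w \in cover Q)) => [/bigcupP[S QS Sw] | Q'w].
    rewrite (bigD1 S) //= Sw big1 // => S' /andP[QS' neqS'].
    case S'w: (w \in S') => //; case/negP: neqS'.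
    have tiP := partition_trivIset partP.
    by rewrite -(def_pblock tiP (sQP _ QS) Sw) (def_pblock tiP (sQP _ QS') S'w).
  rewrite big1 // => S QS; case Sw: (w \in S) => //.
  by case/negP: Q'w; apply/bigcupP; exists S.
have card_walks w : #|[set z | ((w.1, z) \in cover QX) && ((z, w.2) \in cover QY)]|
  = \sum_(S1 in QX) \sum_(S2 in QY)
      #|[set z | ((w.1, z) \in S1) && ((z, w.2) \in S2)]|.
  rewrite -sum1_card big_mkcond /=.
  under eq_bigr => z _.
    rewrite inE (_ : (if _ then _ else _) = \sum_(S1 in QX) \sum_(S2 in QY)
      (((w.1, z) \in S1) && ((z, w.2) \in S2) : nat)%N).
    over.
    under [RHS]eq_bigr => S1 _.
      under eq_bigr => S2 _ do rewrite -mulnb.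
      rewrite -big_distrr -mem_cover //=; over.
    by rewrite -big_distrl -mem_cover //= mulnb; case: ifP.
  rewrite exchange_big; apply: eq_bigr => S1 _ /=.
  rewrite exchange_big; apply: eq_bigr => S2 _ /=.
  rewrite -sum1_card [RHS]big_mkcond; apply: eq_bigr => z _ /=.
  by rewrite inE; case: ifP.
rewrite !card_walks; apply: eq_bigr => S1 QX1; apply: eq_bigr => S2 QY2.
have [c cE] := coefP S1 S2 R (sXP _ QX1) (sYP _ QY2) PR.
by rewrite !cE.
Qed.

End CoherentConfigurations.

(** * Colourings of pairs that yield the WL-closure *)

Section Colorings.

Variables (T C : finType) (e : rel T) (c : T -> T -> C).
Hypothesis e_sym : symmetric e.
Hypothesis c_sym : forall x y, c x y = c y x.
Hypothesis c_surj : forall i, exists x y, c x y = i.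
Hypothesis c_eq : forall x y x' y', c x y = c x' y' -> (x == y) = (x' == y').
Hypothesis c_adj : forall x y x' y', c x y = c x' y' -> e x y = e x' y'.
Hypothesis c_walks : forall i j x y x' y', c x y = c x' y' ->
  #|[set z | (c x z == i) && (c z y == j)]| =
  #|[set z | (c x' z == i) && (c z y' == j)]|.
Hypothesis c_determined : forall x y x' y',
  (x == y) = (x' == y') -> e x y = e x' y' ->
  common_nbrs e x y = common_nbrs e x' y' -> c x y = c x' y'.

Definition color_class i : {set T * T} := [set u | c u.1 u.2 == i].

Definition color_classes := [set color_class i | i : C].

Lemma color_class_inj : injective color_class.
Proof.
move=> i j eq_ij; have [x [y cxy]] := c_surj i.
have : (x, y) \in color_class i by rewrite inE /= cxy.
by rewrite eq_ij inE /= cxy => /eqP.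
Qed.

Lemma color_classes_partition : partition color_classes [set: T * T].
Proof.
apply/and3P; split.
- apply/eqP/setP=> u; rewrite inE; apply/bigcupP.
  by exists (color_class (c u.1 u.2)); rewrite ?imset_f ?inE.
- apply/trivIsetP=> _ _ /imsetP[i _ ->] /imsetP[j _ ->] neq_ij.
  rewrite -setI_eq0; apply/eqP/setP=> u; rewrite !inE.
  by apply: contraNF neq_ij => /andP[/eqP-> /eqP->].
- apply/imsetP=> -[i _ /setP R0]; have [x [y cxy]] := c_surj i.
  by have := R0 (x, y); rewrite !inE /= cxy eqxx.
Qed.

Lemma union_of_color_classes (p : rel T) :
  (forall x y x' y', c x y = c x' y' -> p x y = p x' y') ->
  union_of_classes color_classes [set u | p u.1 u.2].
Proof.
move=> c_p; apply/(union_of_classesP _ color_classes_partition) => R u v.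
case/imsetP=> i _ ->; rewrite !inE => /eqP cu /eqP cv.
by rewrite (c_p _ _ v.1 v.2) // cu.
Qed.

Lemma color_classes_coherent : coherent_configuration color_classes.
Proof.
split=> [|||R1 R2 R3 /imsetP[i _ ->] /imsetP[j _ ->] /imsetP[k _ ->]].
- exact: color_classes_partition.
- exact: (union_of_color_classes c_eq).
- move=> R /imsetP[i _ ->]; apply/imsetP; exists i => //.
  apply/setP=> -[x y]; rewrite inE; apply/imsetP/eqP=> /= [[[x' y']] | cxy].
    by rewrite inE /= => /eqP cxy [-> ->]; rewrite c_sym.
  by exists (y, x) => //; rewrite inE /= c_sym cxy.
have [x [y cxy]] := c_surj k.
exists #|[set z | (c x z == i) && (c z y == j)]| => u; rewrite inE => /eqP cu.
rewrite -(c_walks i j (etrans cu (esym cxy))); apply: eq_card => z.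
by rewrite !inE.
Qed.

(** Surjectivity of [c] makes distinct colours give distinct classes. Minimality comes from
    [c_determined], applied to two pairs in one class of [Q]: their common neighbours are counted by
    walks along two edges. *)
Theorem has_WL_rank_coloring : has_WL_rank e #|C|.
Proof.
exists color_classes; last by rewrite card_imset //; apply: color_class_inj.
split; first exact: color_classes_coherent.
  exact: (union_of_color_classes c_adj).
move=> Q cohQ unionE _ /imsetP[i _ ->].
have [partQ unionD _ _] := cohQ.
apply/(union_of_classesP _ partQ) => R u v QR Ru Rv; rewrite !inE => /eqP<-.
apply/eqP/c_determined.
- by have := mem_union_of_classes partQ unionD QR Rv Ru; rewrite !inE.
- by have := mem_union_of_classes partQ unionE QR Rv Ru; rewrite !inE.
have /= := coherent_card_walks cohQ unionE unionE QR Rv Ru.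
suffices nbrsE x y : #|[set z | ((x, z) \in [set w | e w.1 w.2]) &&
  ((z, y) \in [set w | e w.1 w.2])]| = common_nbrs e x y by rewrite !nbrsE.
by apply: eq_card => z; rewrite !inE /= (e_sym z).
Qed.

End Colorings.

(** * Diameter two, and a count by inclusion-exclusion *)

Lemma has_diameter2 (T : finType) (e : rel T) : symmetric e ->
  (exists x y, x != y /\ ~~ e x y) ->
  (forall x y, x != y -> ~~ e x y -> 0 < common_nbrs e x y) ->
  has_diameter e 2.
Proof.
move=> e_sym [x0 [y0 [neq0 nadj0]]] common_gt0.
have dist2 x y : x != y -> ~~ e x y -> is_dist e x y 2.
  move=> neq_xy nadj; split.
    have /card_gt0P[z] := common_gt0 x y neq_xy nadj.
    rewrite inE => /andP[xz yz]; exists [:: z; y].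
    by split; rewrite //= xz e_sym yz.
  case=> [|z [|? ?]] //=; first by move=> _ eq_xy; rewrite eq_xy eqxx in neq_xy.
  by rewrite andbT => xz eq_zy; rewrite -eq_zy xz in nadj.
split; last by exists x0, y0; apply: dist2.
move=> x y; have [<- | neq_xy] := eqVneq x y.
  by exists 0 => //; split=> //; exists [::].
have [adj | nadj] := boolP (e x y); last by exists 2 => //; apply: dist2.
exists 1%N => //; split; first by exists [:: y]; split; rewrite //= adj.
by case=> //= _ eq_xy; rewrite eq_xy eqxx in neq_xy.
Qed.

(** By inclusion-exclusion, the sizes of [P], [A], [B] and [A :&: B] determine all four regions that
    [A] and [B] cut out of [P]. Both colourings below obtain their walk counts from this. *)
Lemma eq_card_pattern (T : finType) (P A B P' A' B' : {set T}) (a b : bool) :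
  A \subset P -> B \subset P -> A' \subset P' -> B' \subset P' ->
  #|P| = #|P'| -> #|A| = #|A'| -> #|B| = #|B'| -> #|A :&: B| = #|A' :&: B'| ->
  #|[set z in P | ((z \in A) == a) && ((z \in B) == b)]| =
  #|[set z in P' | ((z \in A') == a) && ((z \in B') == b)]|.
Proof.
move=> sAP sBP sAP' sBP' eqP eqA eqB eqI.
have patternE (X Y Z : {set T}) : Y \subset X -> Z \subset X ->
  [set z in X | ((z \in Y) == a) && ((z \in Z) == b)] =
  if a then if b then Y :&: Z else Y :\: Z
  else if b then Z :\: Y else X :\: (Y :|: Z).
  move=> /subsetP sYX /subsetP sZX; apply/setP=> z; move: (sYX z) (sZX z).
  by case: a b => [] []; rewrite !inE; case: (z \in X); case: (z \in Y);
    case: (z \in Z) => //= H1 H2; rewrite ?(H1 isT) ?(H2 isT).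
rewrite !patternE //; case: (a); case: (b) => //; rewrite !cardsD ?eqI ?eqA ?eqB //.
  by rewrite 2![_ :&: _]setIC setIC [B' :&: A']setIC eqI.
by rewrite !(setIidPr _) ?subUset ?sAP ?sAP' // !cardsU eqI eqP eqA eqB.
Qed.

(** * The graphs K_a x K_b *)

Section RookGraphs.

Variables a b : nat.
Let V : finType := ('I_a * 'I_b)%type.
Let e : rel V := cartesian_product (@complete_graph a) (@complete_graph b).
Implicit Types x y z : V.

Lemma rook_adjE x y : e x y = (x.1 == y.1) (+) (x.2 == y.2).
Proof.
by rewrite /e /cartesian_product /complete_graph; case: eqP; case: eqP.
Qed.

Lemma rook_eqE x y : (x == y) = (x.1 == y.1) && (x.2 == y.2).
Proof. by []. Qed.

Lemma rook_simple : simple_graph e.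
Proof.
split=> [x y | x]; rewrite !rook_adjE; last by rewrite !eqxx.
by rewrite eq_sym [x.2 == _]eq_sym.
Qed.

Lemma rook_regular : regular_graph e ((b - 1) + (a - 1))%N.
Proof.
move=> x; rewrite (_ : [set y | _] =
  setX [set x.1] (~: [set x.2]) :|: setX (~: [set x.1]) [set x.2]).
  rewrite cardsU (_ : _ :&: _ = set0).
    by rewrite cards0 subn0 !cardsX !cardsC1 !cards1 !card_ord mul1n muln1 !subn1.
  by apply/setP=> y; rewrite !inE; case: (_ == _); rewrite ?andbF.
apply/setP=> y; rewrite !inE rook_adjE eq_sym [x.2 == _]eq_sym.
by case: (_ == _); case: (_ == _).
Qed.

(** Two vertices on a line have the rest of the line in common; two vertices on no common line have
    the two other corners of their rectangle. *)
Lemma rook_common_nbrs x y : x != y ->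
  common_nbrs e x y = if x.1 == y.1 then (b - 2)%N
                      else if x.2 == y.2 then (a - 2)%N else 2.
Proof.
case: x y => [x1 x2] [y1 y2]; rewrite rook_eqE /= => neq_xy.
rewrite /common_nbrs; case: eqVneq neq_xy => [<- /= neq2 | neq1 _].
  rewrite (_ : [set z | _] = setX [set x1] (~: [set x2; y2])).
    by rewrite cardsX cards1 mul1n cardsCs setCK cards2 neq2 card_ord.
  apply/setP=> -[z1 z2]; rewrite !inE /= !rook_adjE /= eq_sym.
  rewrite [x2 == _]eq_sym [y2 == _]eq_sym negb_or.
  case: (z1 == x1) => //=; apply/negP=> /andP[/eqP eq1 /eqP eq2].
  by rewrite -eq1 -eq2 eqxx in neq2.
case: eqVneq => [<- /= | neq2].
  rewrite (_ : [set z | _] = setX (~: [set x1; y1]) [set x2]).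
    by rewrite cardsX cards1 muln1 cardsCs setCK cards2 neq1 card_ord.
  apply/setP=> -[z1 z2]; rewrite !inE /= !rook_adjE /= [_ == z2]eq_sym.
  rewrite [x1 == _]eq_sym [y1 == _]eq_sym negb_or.
  case: (z2 == x2) => //=; rewrite ?addbT ?andbT // !addbF andbF.
  by apply/negP=> /andP[/eqP eq1 /eqP eq2]; rewrite -eq1 -eq2 eqxx in neq1.
rewrite (_ : [set z | _] = [set (x1, y2); (y1, x2)]).
  by rewrite cards2 rook_eqE /= (negbTE neq1).
apply/setP=> -[z1 z2]; rewrite !inE /= !rook_adjE /= !rook_eqE /=.
rewrite [x1 == _]eq_sym [y1 == _]eq_sym [x2 == _]eq_sym [y2 == _]eq_sym.
have: ~~ ((z1 == x1) && (z1 == y1)).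
  by apply/negP=> /andP[/eqP eq1 /eqP eq2]; rewrite -eq1 -eq2 eqxx in neq1.
have: ~~ ((z2 == x2) && (z2 == y2)).
  by apply/negP=> /andP[/eqP eq1 /eqP eq2]; rewrite -eq1 -eq2 eqxx in neq2.
by do 4![case: (_ == _)].
Qed.

(** The four colours are equality, the two directions of adjacency, and nonadjacency. *)
Let col x y := (x.1 == y.1, x.2 == y.2).

Lemma eq_card_sphere_pattern (T : finType) (s t : bool) (x y x' y' : T) :
  (x == y) = (x' == y') ->
  #|[set z | ((x == z) == s) && ((z == y) == t)]| =
  #|[set z | ((x' == z) == s) && ((z == y') == t)]|.
Proof.
move=> eq_xy.
have pattern1 u v : [set z | ((u == z) == s) && ((z == v) == t)] =
  [set z in [set: T] | ((z \in [set u]) == s) && ((z \in [set v]) == t)].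
  by apply/setP=> z; rewrite !inE [u == z]eq_sym.
have card1I (u v : T) : #|[set u] :&: [set v]| = (u == v).
  have [-> | neq_uv] := eqVneq; first by rewrite setIid cards1.
  apply/eqP; rewrite cards_eq0; apply/eqP/setP=> z; rewrite !inE.
  by have [-> | ] := eqVneq z u; rewrite ?(negbTE neq_uv).
rewrite !pattern1.
by apply: eq_card_pattern; rewrite ?subsetT ?cards1 ?card1I ?eq_xy.
Qed.

(** The two directions of adjacency are told apart by their numbers [b - 2] and [a - 2] of common
    neighbours, which differ when [a != b]. *)
Lemma rook_WL_rank : 1 < a -> 1 < b -> a != b -> has_WL_rank e 4.
Proof.
move=> a_gt1 b_gt1 neq_ab.
have -> : 4 = #|{: bool * bool}| by rewrite card_prod card_bool.
apply: (@has_WL_rank_coloring _ _ _ col).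
- by case: rook_simple.
- by move=> x y; rewrite /col eq_sym [x.2 == _]eq_sym.
- case=> s t.
  have pair (n : nat) (r : bool) : 1 < n -> exists i j : 'I_n, (i == j) = r.
    move=> n_gt1; exists (Ordinal (ltnW n_gt1)).
    by case: r; [exists (Ordinal (ltnW n_gt1)) | exists (Ordinal n_gt1)].
  have [i [j <-]] := pair a s a_gt1; have [i' [j' <-]] := pair b t b_gt1.
  by exists (i, i'), (j, j').
- by move=> x y x' y' [eq1 eq2]; rewrite !rook_eqE eq1 eq2.
- by move=> x y x' y' [eq1 eq2]; rewrite !rook_adjE eq1 eq2.
- move=> [s1 s2] [t1 t2] x y x' y' [eq1 eq2].
  (* The colouring is a product, so walks can be counted one coordinate at a time. *)
  have prodE u v : [set z | (col u z == (s1, s2)) && (col z v == (t1, t2))] =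
    setX [set z | ((u.1 == z) == s1) && ((z == v.1) == t1)]
         [set z | ((u.2 == z) == s2) && ((z == v.2) == t2)].
    by apply/setP=> -[z1 z2]; rewrite !inE /= !xpair_eqE /= andbACA.
  by rewrite !prodE !cardsX; congr (_ * _)%N; apply: eq_card_sphere_pattern.
move=> x y x' y'; rewrite /col.
have [-> /esym/eqP-> | neq eq_neq] := eqVneq x y; first by rewrite !eqxx.
rewrite !rook_common_nbrs // -?eq_neq // !rook_adjE.
move: neq eq_neq; rewrite !rook_eqE.
by do 4!case: (_ == _) => //=; lia.
Qed.

End RookGraphs.

(** The size 4 makes [a - 2] equal to the number 2 for nonadjacent pairs, so only 2 and [m - 2]
    occur. Both occur on edges and they differ, which rules out strong regularity. *)
Lemma rook4_strictly_deza m : 1 < m -> m != 4 ->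
  strictly_deza (cartesian_product (@complete_graph 4) (@complete_graph m)).
Proof.
move=> m_gt1 m_neq4; set e := cartesian_product _ _.
have commonE := @rook_common_nbrs 4 m.
pose i0 := Ordinal (ltnW m_gt1); pose i1 := Ordinal m_gt1.
pose j0 := @Ordinal 4 0 isT; pose j1 := @Ordinal 4 1 isT.
split.
- exists (4 * m)%N, ((m - 1) + (4 - 1))%N, (m - 2)%N, 2; split.
  + exact: rook_simple.
  + by rewrite card_prod !card_ord.
  + exact: rook_regular.
  move=> x y /commonE->; case: ifP => _; first by right.
  by left; case: ifP.
- case=> _ [k [l [r [_ adjE _]]]].
  have := adjE (j0, i0) (j1, i0) isT; have := adjE (j0, i0) (j0, i1) isT.
  by rewrite !commonE //= => <-; lia.
apply: has_diameter2; first by case: (rook_simple 4 m).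
  by exists (j0, i0), (j1, i1).
move=> x y neq_xy; rewrite /e rook_adjE commonE //.
by move: neq_xy; rewrite rook_eqE; case: (_ == _); case: (_ == _).
Qed.

(** * Symmetric designs *)

(* [b] is the incidence graph of a symmetric (n, k, l)-design, with [side]
   telling points from blocks, and [e] makes both sides complete. *)
Section SymmetricDesigns.

Variables (T : finType) (side : pred T) (b e : rel T) (n k l : nat).
Hypothesis card_side : forall s : bool, #|[set z | side z == s]| = n.
Hypothesis b_sym : symmetric b.
Hypothesis b_cross : forall x y, b x y -> side x != side y.
Hypothesis b_regular : regular_graph b k.
Hypothesis b_common :
  forall x y, x != y -> side x = side y -> common_nbrs b x y = l.
Hypothesis n_gt1 : 1 < n.
Hypothesis k_gt0 : 0 < k.
Hypothesis k_ltn : k < n.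

Hypothesis eE : forall x y, e x y = (x != y) && (side x == side y) || b x y.

Let nbr x := [set z | b x z].
Let same x := [set z | side z == side x].

Lemma mem_same_nbr x y : side x = side y -> (y \in nbr x) = false.
Proof. by move=> eq_side; rewrite inE; apply/negP=> /b_cross/eqP. Qed.

Lemma side_exists s : exists x, side x = s.
Proof.
have /card_gt0P[x]: 0 < #|[set z | side z == s]| by rewrite card_side ltnW.
by rewrite inE => /eqP; exists x.
Qed.

Lemma adjacent_exists : exists x y, b x y.
Proof.
have [x _] := side_exists true; have /card_gt0P[y]: 0 < #|nbr x|.
  by rewrite b_regular.
by rewrite inE; exists x, y.
Qed.

Lemma same_side_exists : exists x y, x != y /\ side x = side y.
Proof.
have [x _] := side_exists true.
have /card_gt0P[y]: 0 < #|same x :\ x|.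
  by have := cardsD1 x (same x); rewrite card_side inE eqxx; lia.
by rewrite !inE => /andP[neq_yx /eqP eq_side]; exists x, y; rewrite eq_sym.
Qed.

Lemma nonadjacent_exists : exists x y, side x != side y /\ ~~ b x y.
Proof.
have [x _] := side_exists true.
have /card_gt0P[y]: 0 < #|[set z | side z == ~~ side x] :\: nbr x|.
  rewrite cardsD card_side.
  by have := subset_leq_card (subsetIr [set z | side z == ~~ side x] (nbr x));
    rewrite b_regular; lia.
rewrite !inE => /andP[nadj /eqP side_y]; exists x, y.
by rewrite side_y; case: (side x).
Qed.

Lemma clique_design_simple : simple_graph e.
Proof.
split=> [x y | x]; rewrite !eE.
  by rewrite eq_sym [side x == _]eq_sym b_sym.
by rewrite eqxx /=; apply/negP=> /b_cross/eqP.
Qed.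

Lemma clique_design_regular : regular_graph e ((n - 1) + k)%N.
Proof.
move=> x; rewrite (_ : [set y | _] = (same x :\ x) :|: nbr x).
  rewrite cardsU (_ : _ :&: _ = set0).
    have := cardsD1 x (same x); rewrite card_side inE eqxx cards0 subn0.
    by rewrite (b_regular x) => ->; rewrite add1n subn1.
  apply/setP=> y; rewrite !inE; case: (y == x) => //=.
  case: eqP => //= eq_side.
  by have := mem_same_nbr (esym eq_side); rewrite inE => ->.
by apply/setP=> y; rewrite !inE !eE eq_sym [side x == _]eq_sym.
Qed.

(** The clique contributes the other [n - 2] vertices of the side, and the design contributes [l]
    vertices across. *)
Lemma common_nbrs_same_side x y : x != y -> side x = side y ->
  common_nbrs e x y = (n - 2 + l)%N.
Proof.
move=> neq_xy eq_side; rewrite /common_nbrs.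
rewrite (_ : [set z | _] = (same x :\ x :\ y) :|: (nbr x :&: nbr y)).
  rewrite cardsU (_ : _ :&: (_ :&: _) = set0) ?cards0 ?subn0.
    rewrite -(b_common neq_xy eq_side); congr (_ + _)%N.
      have := cardsD1 y (same x :\ x); have := cardsD1 x (same x).
      by rewrite card_side !inE !eqxx eq_sym neq_xy eq_side eqxx /=; lia.
    by apply: eq_card => z; rewrite !inE.
  apply/setP=> z; rewrite !inE; case: eqVneq => //= _; case: eqVneq => //= _.
  by case: eqP => //= eq_zx; apply/negP=> /andP[/b_cross]; rewrite eq_zx eqxx.
apply/setP=> z; rewrite !inE !eE [z == x]eq_sym [z == y]eq_sym -eq_side.
have/implyP := @b_cross x z; have/implyP := @b_cross y z.
rewrite -eq_side [side z == _]eq_sym; case: (x == z); case: (y == z);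
  by case: (b x z); case: (b y z); case: (side x == side z).
Qed.

(** A common neighbour on the side of [y] is a [b]-neighbour of [x] other than [y], and
    symmetrically on the side of [x]. *)
Lemma common_nbrs_cross x y : side x != side y ->
  common_nbrs e x y = (2 * (k - b x y))%N.
Proof.
move=> cross; rewrite /common_nbrs.
have cardD u v : #|nbr u :\ v| = (k - b u v)%N.
  by have := cardsD1 v (nbr u); rewrite inE (b_regular u) => ->; rewrite addKn.
rewrite (_ : [set z | _] = (nbr x :\ y) :|: (nbr y :\ x)).
  rewrite cardsU (_ : _ :&: _ = set0) ?cards0 ?subn0.
    by rewrite !cardD [b y x]b_sym mul2n addnn.
  apply/setP=> z; rewrite !inE; apply/negP.
  case/andP=> /andP[_ /b_cross xz] /andP[_ /b_cross yz].
  by move: cross xz yz; case: (side x); case: (side y); case: (side z).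
apply/setP=> z; rewrite !inE !eE [z == x]eq_sym [z == y]eq_sym.
have/implyP := @b_cross x z; have/implyP := @b_cross y z; move: cross.
have [->|_] := eqVneq x z; have [->|_] := eqVneq y z; rewrite ?eqxx //=;
  by case: (b _ z); case: (b _ z); case: (side x); case: (side y); case: (side z).
Qed.

Hypothesis parameters : (2 * k + 2 = n + l)%N.

Let common_nbrs_same_side2k x y : x != y -> side x = side y ->
  common_nbrs e x y = (2 * k)%N.
Proof. by move=> neq_xy /common_nbrs_same_side->//; lia. Qed.

(** Edges inside a side have [2 * k] common neighbours and edges across have [2 * (k - 1)], so
    [0 < k] excludes strong regularity; [k < n] provides a nonadjacent pair. *)
Lemma clique_design_strictly_deza : strictly_deza e.
Proof.
split.
- exists (2 * n)%N, ((n - 1) + k)%N, (2 * k)%N, (2 * (k - 1))%N; split.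
  + exact: clique_design_simple.
  + rewrite -cardsT (_ : setT = [set z | side z == true] :|:
      [set z | side z == false]).
      rewrite cardsU (_ : _ :&: _ = set0) ?cards0 ?subn0 ?card_side.
        by rewrite mul2n addnn.
      by apply/setP=> z; rewrite !inE; case: (side z).
    by apply/setP=> z; rewrite !inE; case: (side z).
  + exact: clique_design_regular.
  move=> x y neq_xy; case: (eqVneq (side x) (side y)) => [eq_side | cross].
    by right; apply: common_nbrs_same_side2k.
  rewrite (common_nbrs_cross cross).
  by case: (b x y); [left | right; rewrite subn0].
- case=> _ [d [lam [mu [_ adjE _]]]].
  have [x [y [neq_xy eq_side]]] := same_side_exists.
  have [x' [y' adj]] := adjacent_exists.
  have := adjE x y; rewrite !eE neq_xy eq_side eqxx => /(_ isT).
  rewrite common_nbrs_same_side2k //.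
  have := adjE x' y'; rewrite !eE adj orbT => /(_ isT).
  by rewrite common_nbrs_cross ?b_cross // adj; lia.
apply: has_diameter2; first by case: clique_design_simple.
  have [x [y [cross nadj]]] := nonadjacent_exists.
  exists x, y; rewrite !eE negb_or (negbTE cross) andbF nadj.
  by split=> //; apply: contraNneq cross => ->.
move=> x y neq_xy; rewrite !eE neq_xy negb_or => /andP[cross nadj].
by rewrite common_nbrs_cross // (negbTE nadj); lia.
Qed.

(** Since [b] only joins opposite sides, the colours are equality, distinct on one side, incident
    across and nonincident across. *)
Let col x y := (side x == side y, (x == y) || b x y).

(** On the part of the vertices selected by [s] (the side of [x] or the other one), [mate s x] is
    where the second component of the colour is true. This brings walks into the form of
    [eq_card_pattern]. *)
Let mate s x := if s then [set x] else nbr x.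

Let mateE x z s t : (col x z == (s, t)) =
  ((side x == side z) == s) && ((z \in mate s x) == t).
Proof.
rewrite /col xpair_eqE.
case: (eqVneq (side x)) => [eq_side | neq_side]; case: s => //=.
  have := mem_same_nbr eq_side; rewrite !inE => ->.
  by rewrite orbF [x == z]eq_sym.
by rewrite inE; case: (eqVneq x z) neq_side => // ->; rewrite eqxx.
Qed.

Let card_mate s x : #|mate s x| = if s then 1%N else k.
Proof. by case: s; rewrite /mate ?cards1 ?b_regular. Qed.

Let sub_mate s x : mate s x \subset [set z | (side x == side z) == s].
Proof.
apply/subsetP=> z; case: s; rewrite /mate !inE; first by move/eqP->; rewrite eqxx.
by move/b_cross/negbTE->.
Qed.

Let mate_sym s x y : (x \in mate s y) = (y \in mate s x).
Proof. by case: s; rewrite !inE 1?b_sym // eq_sym. Qed.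

(** The hypothesis says that [s] seen from [x] and [t] seen from [y] select the same side. Unless
    both sets are neighbourhoods, one is a singleton and the intersection amounts to a
    membership. *)
Let card_mateI s t x y : (side x == side y) = (s == t) ->
  #|mate s x :&: mate t y| =
  if s || t then (y \in mate (s == t) x : nat)
  else if x == y then k else l.
Proof.
have cardI1 (X : {set T}) z : #|X :&: [set z]| = (z \in X).
  case: (boolP (z \in X)) => [Xz | X'z].
    by rewrite (setIidPr _) ?cards1 // sub1set.
  apply/eqP; rewrite cards_eq0; apply/eqP/setP=> u; rewrite !inE.
  by case: eqP => [-> | _]; rewrite ?andbF ?(negbTE X'z).
case: s t => [] [] /= eq_side; rewrite ?cardI1 //.
  by rewrite setIC cardI1 (mate_sym false).
have [<- | neq_xy] := eqVneq x y; first by rewrite setIid b_regular.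
rewrite -(b_common neq_xy (eqP eq_side)).
by apply: eq_card => z; rewrite !inE.
Qed.

(** With only two sides, agreement of sides composes like parity. *)
Let side_eq x y z s t : (side x == side z) = s -> (side z == side y) = t ->
  (side x == side y) = (s == t).
Proof. by move=> <- <-; case: (side x); case: (side y); case: (side z). Qed.

Let side_eqr x y z s t : (side x == side y) = (s == t) ->
  (side x == side z) = s -> (side z == side y) = t.
Proof.
by case: s t => [] [];
  case: (side x); case: (side y); case: (side z).
Qed.

Let col_eq x y x' y' : col x y = col x' y' -> (x == y) = (x' == y').
Proof.
case; case: (eqVneq x y) => [-> | neq]; case: (eqVneq x' y') => [-> | neq'] //=.
  by rewrite eqxx => /esym/eqP eq_side /esym; have := mem_same_nbr eq_side;
    rewrite inE => ->.
by rewrite eqxx => /eqP eq_side; have := mem_same_nbr eq_side; rewrite inE => ->.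
Qed.

Let col_b x y x' y' : col x y = col x' y' -> b x y = b x' y'.
Proof.
have neqF u v : side u != side v -> (u == v) = false.
  by move=> neq; apply: contraNF neq => /eqP->.
case; case: (eqVneq (side x) (side y)) => [xy | neq];
  case: (eqVneq (side x') (side y')) => [xy' | neq'] // _.
  by have := mem_same_nbr xy; have := mem_same_nbr xy'; rewrite !inE => -> ->.
by rewrite !neqF.
Qed.

Theorem clique_design_WL_rank : has_WL_rank e 4.
Proof.
have -> : 4 = #|{: bool * bool}| by rewrite card_prod card_bool.
apply: (@has_WL_rank_coloring _ _ _ col).
- by case: clique_design_simple.
- by move=> x y; rewrite /col eq_sym [x == _]eq_sym b_sym.
- case=> [] [] [].
  + by have [x _] := side_exists true; exists x, x; rewrite /col !eqxx.
  + have [x [y [/negbTE neq_xy eq_side]]] := same_side_exists; exists x, y.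
    by have := mem_same_nbr eq_side; rewrite /col neq_xy eq_side eqxx inE => ->.
  + have [x [y adj]] := adjacent_exists; exists x, y.
    by rewrite /col adj orbT (negbTE (b_cross adj)).
  have [x [y [cross nadj]]] := nonadjacent_exists; exists x, y.
  rewrite /col (negbTE nadj) (negbTE cross).
  by case: (eqVneq x y) cross => // ->; rewrite eqxx.
- exact: col_eq.
- move=> x y x' y' eq_col; have [eq_side _] := eq_col.
  by rewrite !eE (col_eq eq_col) eq_side (col_b eq_col).
- move=> [s1 s2] [t1 t2] x y x' y' eq_col; have [eq_side _] := eq_col.
  have patternE u v : (side u == side v) = (s1 == t1) ->
    [set z | (col u z == (s1, s2)) && (col z v == (t1, t2))] =
    [set z in [set z | (side u == side z) == s1] |
      ((z \in mate s1 u) == s2) && ((z \in mate t1 v) == t2)].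
    move=> uv; apply/setP=> z; rewrite inE 2!inE !mateE (mate_sym t1 v).
    case: eqP => //= uz; case: (_ == s2) => //=.
    by rewrite (side_eqr uv uz) eqxx.
  (* If the parities disagree, the middle vertex would need to lie on both sides, so there is no
     walk at all. *)
  have [xy | nxy] := boolP ((side x == side y) == (s1 == t1)); last first.
    have empty u v : (side u == side v) != (s1 == t1) ->
      #|[set z | (col u z == (s1, s2)) && (col z v == (t1, t2))]| = 0.
      move=> nuv; apply: eq_card0 => z; rewrite !inE; apply/negP.
      case/andP; rewrite !mateE => /andP[/eqP uz _] /andP[/eqP zv _].
      by rewrite (side_eq uz zv) eqxx in nuv.
    by rewrite !empty // -eq_side.
  have x'y' := xy; rewrite eq_side in x'y'.
  rewrite !patternE ?(eqP xy) ?(eqP x'y') //.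
  have sub_mate' u v : (side u == side v) = (s1 == t1) ->
    mate t1 v \subset [set z | (side u == side z) == s1].
    move=> uv; apply: subset_trans (sub_mate _ _) _; apply/subsetP=> z.
    rewrite !inE => /eqP vz; apply/eqP; move: uv; rewrite -vz.
    by case: (side u); case: (side v); case: (side z); case: (s1).
  apply: eq_card_pattern; rewrite ?sub_mate ?card_mate //.
  + exact: sub_mate' (eqP xy).
  + exact: sub_mate' (eqP x'y').
  + have sideE u : [set z | (side u == side z) == s1] =
      [set z | side z == (if s1 then side u else ~~ side u)].
      by apply/setP=> z; rewrite !inE; case: (s1); case: (side u); case: (side z).
    by rewrite !sideE !card_side.
  rewrite (card_mateI (eqP xy)) (card_mateI (eqP x'y')).
  rewrite (col_eq eq_col); case: ifP => // _; congr (nat_of_bool _).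
  case: (s1 == t1); rewrite /mate !inE ?(col_b eq_col) //.
  by rewrite [y == _]eq_sym [y' == _]eq_sym (col_eq eq_col).
(* Among distinct pairs only adjacency covers two colours, and these have [2 * k] and [2 * (k - 1)]
   common neighbours. *)
move=> x y x' y'; rewrite /col.
have [-> /esym/eqP-> | neq eq_neq] := eqVneq x y; first by rewrite !eqxx.
rewrite -eq_neq !eE neq -eq_neq /=.
have neq' : x' != y' by rewrite -eq_neq.
case: (eqVneq (side x) (side y)) => [xy | cross];
  case: (eqVneq (side x') (side y')) => [xy' | cross'] /=.
- have := mem_same_nbr xy; have := mem_same_nbr xy'.
  by rewrite !inE => -> ->.
- move=> adj; rewrite (common_nbrs_same_side2k neq xy).
  by rewrite (common_nbrs_cross cross') -adj /=; lia.
- move=> adj; rewrite (common_nbrs_cross cross).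
  by rewrite (common_nbrs_same_side2k neq' xy') adj /=; lia.
by move=> ->.
Qed.

End SymmetricDesigns.

(** * Dihedral groups *)

(** The presentation in [Grp_dihedral] uses [x ^ y]; once [y ^+ 2 = 1], this conjugate is
    [y * x * y]. *)
Lemma dihedral_gtype_is_dihedral n :
  1 < n -> is_dihedral n ('D_(n.*2))%type.
Proof.
move=> n_gt1 rT H; rewrite Grp_dihedral //.
apply: eq_existsb => [[x y]] /=; rewrite !xpair_eqE; do 2!congr (_ && _).
have [y2 | //] := eqVneq (y ^+ 2) 1; congr (_ && (_ == _)).
have /eqP yV : y^-1 == y by rewrite eq_invg_mul; apply/eqP.
by rewrite conjgE yV mulgA.
Qed.

(** Groups with the same presentation are homomorphic images of each other, hence isomorphic. *)
Lemma is_dihedral_card n (gT : finGroupType) :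
  1 < n -> is_dihedral n gT -> #|gT| = (2 * n)%N.
Proof.
move=> n_gt1 isoG; have isoD := dihedral_gtype_is_dihedral n_gt1.
rewrite mul2n -(card_dihedral n_gt1) -cardsT.
apply: card_isog; rewrite isogEhom.
by rewrite isoD -isoG homg_refl isoG -isoD homg_refl.
Qed.

Section DihedralPresentation.

Variables (n : nat) (gT : finGroupType) (x y : gT).
Hypothesis n_gt1 : 1 < n.
Hypothesis presG : dihedral_presentation n x y.

Lemma dihedral_cardG : #|gT| = (2 * n)%N.
Proof. by case: presG => isoG _ _; apply: is_dihedral_card. Qed.

Lemma dihedral_mulyy : y * y = 1.
Proof. by case: presG => _ _ [_ y2 _]. Qed.

Lemma dihedral_conjy a : a \in <[x]> -> a ^ y = a^-1.
Proof.
case/cycleP=> i ->; rewrite conjXg -expgVn; congr (_ ^+ _).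
have /eqP yV : y^-1 == y by rewrite eq_invg_mul dihedral_mulyy.
by case: presG => _ _ [_ _ <-]; rewrite conjgE yV mulgA.
Qed.

Lemma dihedral_yay a : a \in <[x]> -> y * a * y = a^-1.
Proof.
move=> Aa; rewrite -(dihedral_conjy Aa) conjgE mulgA; congr (_ * _ * _).
by apply/esym/eqP; rewrite eq_invg_mul dihedral_mulyy.
Qed.

Lemma dihedral_norm_cycle : y \in 'N(<[x]>).
Proof.
apply/normP; rewrite -cycleJ (dihedral_conjy (cycle_id x)); exact: cycleV.
Qed.

Lemma dihedral_mul_cycles : <[x]> * <[y]> = [set: gT].
Proof.
case: presG => _ <- _; rewrite -norm_joinEr ?cycle_subG ?dihedral_norm_cycle //.
by rewrite joing_idl joing_idr.
Qed.

(** The relations bound the orders by [n] and 2; the product of the two cycles has [2 * n] elements,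
    which forces equality. *)
Lemma dihedral_orders : #[x] = n /\ #[y] = 2.
Proof.
have ltn0 : 0 < n by apply: ltnW.
have [_ _ [xn y2 _]] := presG.
have /(dvdn_leq ltn0) ox : #[x] %| n by rewrite order_dvdn xn.
have /(dvdn_leq (isT : 0 < 2)) oy : #[y] %| 2 by rewrite order_dvdn y2.
have := mul_cardG <[x]> <[y]>; rewrite dihedral_mul_cycles cardsT dihedral_cardG.
have := cardG_gt0 (<[x]> :&: <[y]>)%G; rewrite /= -!orderE.
move: #[x] #[y] #|_| ox oy => p q r ox oy r_gt0 eq_pq.
have : (n * q <= n * 2)%N by rewrite leq_mul2l oy orbT.
have : (p * q <= n * q)%N by rewrite leq_mul2r ox orbT.
by split; nia.
Qed.

Lemma dihedral_card_cycle : #|<[x]>| = n.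
Proof. by case: dihedral_orders. Qed.

Lemma dihedral_notin_cycle g h : g \notin <[x]> -> h \notin <[x]> ->
  g * h^-1 \in <[x]>.
Proof.
move=> A'g A'h; have : g \in ~: <[x]> by rewrite inE.
suffices -> : ~: <[x]> = <[x]> :* h by rewrite mem_rcoset.
apply/eqP; rewrite eq_sym eqEcard card_rcoset; apply/andP; split; last first.
  by have := cardsC <[x]>; rewrite dihedral_cardG dihedral_card_cycle; lia.
apply/subsetP=> u; rewrite mem_rcoset inE => Auh.
apply: contra A'h => Au; have := groupM (groupVr Auh) Au.
by rewrite invMg invgK mulgKV.
Qed.

Lemma dihedral_y_notin : y \notin <[x]>.
Proof.
apply/negP=> Ay; have := dihedral_mul_cycles.
rewrite mulGSid ?cycle_subG // => eqA.
have := dihedral_cardG; rewrite -cardsT -eqA dihedral_card_cycle; lia.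
Qed.

End DihedralPresentation.

Lemma dihedral_presentation_exists n (gT : finGroupType) :
  is_dihedral n gT -> exists x y : gT, dihedral_presentation n x y.
Proof.
move=> isoG; have /existsP[[x y] /=] := isoGrp_hom isoG.
rewrite !xpair_eqE => /and4P[/eqP genG /eqP xn /eqP y2 /eqP rel].
exists x, y; split=> //.
by rewrite -genG joing_idl joing_idr.
Qed.

(** * Cayley graphs from exact factorizations *)

Lemma cayleyE (gT : finGroupType) (S : {set gT}) g h :
  cayley S g h = (h * g^-1 \in S).
Proof. by rewrite /cayley mem_rcoset. Qed.

Lemma coset_index_exists (gT : finGroupType) (K : {group gT}) a :
  #|gT| = (a * #|K|)%N ->
  exists u : gT -> 'I_a, forall g h, (u g == u h) = (h * g^-1 \in K).
Proof.
move=> cardG.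
have index_K : #|rcosets K [set: gT]| = a.
  apply/eqP; rewrite -(eqn_pmul2r (cardG_gt0 K)) -cardG mulnC -cardsT.
  by rewrite (Lagrange (subsetT K)).
have memK g : K :* g \in rcosets K [set: gT].
  by rewrite mem_rcosets mulSGid ?subsetT ?inE.
exists (fun g => cast_ord index_K (enum_rank_in (memK 1) (K :* g))) => g h.
rewrite (inj_eq (@cast_ord_inj _ _ _)).
apply/eqP/idP => [/(congr1 enum_val) | Khg].
  by rewrite !enum_rankK_in // => eq_gh; rewrite -mem_rcoset eq_gh rcoset_refl.
by rewrite (rcoset_eqP (_ : h \in K :* g)) // mem_rcoset.
Qed.

(** The coordinates of an element are its right cosets of [K] and of [H]. They determine it because
    the intersection is trivial, and every pair of cosets occurs by counting. Exactly one coordinate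
    agrees when the quotient lies in exactly one of [H] and [K]. *)
Lemma rook_graph_iso (gT : finGroupType) (H K : {group gT}) :
  H :&: K = 1 -> #|gT| = (#|H| * #|K|)%N ->
  graph_iso (cartesian_product (@complete_graph #|H|) (@complete_graph #|K|))
            (cayley (H^# :|: K^#)).
Proof.
move=> tiHK cardG.
have [u uE] := coset_index_exists cardG.
rewrite mulnC in cardG; have [v vE] := coset_index_exists cardG.
have memHK w : (w \in H) && (w \in K) = (w == 1) by rewrite -in_setI tiHK inE.
pose f g := (u g, v g).
have f_inj : injective f.
  move=> g h [/eqP ugh /eqP vgh]; apply/esym/(mulIg g^-1)/eqP.
  by rewrite mulgV -memHK -uE -vE ugh vgh.
have /(inj_card_bij f_inj)[f' fK f'K] : #|{: 'I_#|H| * 'I_#|K|}| <= #|gT|.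
  by rewrite card_prod !card_ord cardG mulnC.
exists f'; first by exists f.
move=> p q; rewrite -[p]f'K -[q]f'K !fK rook_adjE cayleyE /= uE vE !inE.
rewrite -memHK.
by case: (_ \in H); case: (_ \in K).
Qed.

Lemma connection_set_groupsD1 (gT : finGroupType) (H K : {group gT}) :
  connection_set (H^# :|: K^#).
Proof.
split; first by rewrite !inE eqxx.
by apply/setP=> g; rewrite !inE !groupV eq_invg1.
Qed.

Section ExactFactorization.

Variables (n p q : nat) (gT : finGroupType) (x y : gT).
Hypothesis n_gt1 : 1 < n.
Hypothesis presG : dihedral_presentation n x y.

(* G = <x^p> <x^q> <y>, and the last two factors generate a dihedral group. *)
Lemma dihedral_factorization : n = (p * q)%N -> coprime p q ->
  exists H K : {group gT}, [/\ H :&: K = 1, #|H| = q & #|K| = (2 * p)%N].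
Proof.
move=> n_pq co_pq; have [ox oy] := dihedral_orders n_gt1 presG.
have [p_gt0 q_gt0] : 0 < p /\ 0 < q by apply/andP; rewrite -muln_gt0 -n_pq ltnW.
have oxp : #|<[x ^+ p]>| = q.
  by rewrite -orderE orderXdiv ox n_pq ?mulKn ?dvdn_mulr.
have oxq : #|<[x ^+ q]>| = p.
  by rewrite -orderE orderXdiv ox n_pq ?mulnK ?dvdn_mull.
have eq_x : <[x ^+ p]> * <[x ^+ q]> = <[x]>.
  apply/eqP; rewrite eqEcard mul_subG ?cycleX //= coprime_cardMg oxp oxq.
    by rewrite -orderE ox n_pq mulnC leqnn.
  by rewrite coprime_sym.
have nxq : <[y]> \subset 'N(<[x ^+ q]>).
  rewrite cycle_subG; apply/normP; rewrite -cycleJ.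
  by rewrite (dihedral_conjy presG) ?mem_cycle // cycleV.
have genG : <[x ^+ p]> * (<[x ^+ q]> <*> <[y]>) = [set: gT].
  by rewrite norm_joinEr // mulgA eq_x (dihedral_mul_cycles presG).
exists <[x ^+ p]>%G, (<[x ^+ q]> <*> <[y]>)%G.
(* An upper bound on the second factor suffices: comparing it with the order [2 * p * q] of the
   whole group forces a trivial intersection, and then the exact order. *)
have leK : #|<[x ^+ q]> <*> <[y]>| <= p * 2.
  have := mul_cardG <[x ^+ q]> <[y]>; rewrite norm_joinEr // oxq -[#|<[y]>|]/#[y] oy.
  by move->; rewrite leq_pmulr ?cardG_gt0.
have := mul_cardG <[x ^+ p]> (<[x ^+ q]> <*> <[y]>).
rewrite /= genG cardsT (dihedral_cardG n_gt1 presG) oxp n_pq => eq_card.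
have I1 : #|<[x ^+ p]> :&: (<[x ^+ q]> <*> <[y]>)| = 1%N.
  apply/eqP; rewrite eqn_leq cardG_gt0 andbT.
  rewrite -(@leq_pmul2l (2 * (p * q))) ?muln_gt0 ?p_gt0 // -eq_card muln1.
  by rewrite mulnC mulnA leq_mul2r mulnC leK orbT.
split=> //; first by apply/eqP; rewrite trivg_card1 /= I1.
by apply/eqP; rewrite -(eqn_pmul2l q_gt0) eq_card I1 muln1 mulnA mulnC.
Qed.

End ExactFactorization.

(** For odd [m], take [p = 2] and [q = m], so that the dihedral factor has order 4. Otherwise
    [m = 2 * r] with [r] odd; take [p = r] and [q = 4], so that the cyclic factor has order 4. *)
Lemma rook4_dihedrant m : 1 < m -> ~~ (4 %| m) ->
  dihedrant (cartesian_product (@complete_graph 4) (@complete_graph m)).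
Proof.
move=> m_gt1 m_n4; have n_gt1 : 1 < 2 * m by lia.
pose gT : finGroupType := ('D_((2 * m).*2))%type.
have isoG : is_dihedral (2 * m) gT by apply: dihedral_gtype_is_dihedral.
have [x [y presG]] := dihedral_presentation_exists isoG.
have [H [K [tiHK oH oK]]] :
    exists H K : {group gT}, [/\ H :&: K = 1, #|H| = 4 & #|K| = m].
  have [odd_m | even_m] := boolP (odd m).
    have [H [K [tiHK oH oK]]] := dihedral_factorization n_gt1 presG (erefl _)
      (etrans (coprime2n m) odd_m).
    by exists K, H; rewrite setIC.
  have [r def_m] : exists r, m = (2 * r)%N by exists m./2; lia.
  have co_r4 : coprime r (2 ^ 2).
    by rewrite (@coprime_pexpr 2) // coprimen2; lia.
  have [|H [K [tiHK oH oK]]] := dihedral_factorization n_gt1 presG _ co_r4.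
    by lia.
  by exists H, K; rewrite def_m.
exists (2 * m)%N, gT, (H^# :|: K^#); split=> //.
- by lia.
- exact: connection_set_groupsD1.
have := @rook_graph_iso gT H K tiHK; rewrite oH oK; apply.
by rewrite (dihedral_cardG n_gt1 presG); lia.
Qed.

(** * The design of a difference set inside a dihedral group *)

Section DifferenceSets.

Variables (n : nat) (gT : finGroupType) (x y : gT) (D : {set gT}) (k l : nat).
Hypothesis n_gt2 : 2 < n.
Hypothesis presG : dihedral_presentation n x y.
Hypothesis diffD : difference_set <[x]> D n k l.

Let n_gt1 : 1 < n := ltnW n_gt2.
Local Notation A := <[x]>.

Let sDA : D \subset A. Proof. by case: diffD. Qed.

(** Since [y] inverts [A], the square of [y * d] is [d^-1 * d]. *)
Lemma lcoset_involution s : s \in y *: D -> s^-1 = s.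
Proof.
case/lcosetP=> d /(subsetP sDA) Ad ->; apply/eqP; rewrite eq_invg_mul mulgA.
by rewrite (dihedral_yay presG Ad) mulVg.
Qed.

Lemma mem_lcosetV s : (s^-1 \in y *: D) = (s \in y *: D).
Proof.
apply/idP/idP => yDs; last by rewrite lcoset_involution.
by rewrite -[s]invgK lcoset_involution.
Qed.

Lemma lcoset_notin_cycle s : s \in y *: D -> s \notin A.
Proof.
case/lcosetP=> d /(subsetP sDA) Ad ->.
by rewrite groupMr // (dihedral_y_notin n_gt1 presG).
Qed.

Lemma connection_set_lcoset : connection_set (A^# :|: y *: D).
Proof.
split.
  rewrite !inE eqxx /=; apply/negP=> /lcoset_notin_cycle.
  by rewrite group1.
by apply/setP=> s; rewrite mem_invg !in_setU mem_lcosetV !in_setD1 groupV eq_invg1.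
Qed.

Let b := cayley (y *: D).

(** As [A] has index two, membership in [A] can serve as the predicate [side] of the design. *)
Lemma mem_cycle_div g h : (h * g^-1 \in A) = ((g \in A) == (h \in A)).
Proof.
have [Ag | A'g] := boolP (g \in A); first by rewrite groupMr ?groupV.
have [Ah | A'h] := boolP (h \in A).
  by rewrite groupMl // groupV (negbTE A'g).
by rewrite (dihedral_notin_cycle n_gt1 presG).
Qed.

Lemma difference_card_side (s : bool) : #|[set z | (z \in A) == s]| = n.
Proof.
have cardA := dihedral_card_cycle n_gt1 presG.
case: s.
  by rewrite -[RHS]cardA; apply: eq_card => z; rewrite inE eqb_id.
have := cardsC A; rewrite (dihedral_cardG n_gt1 presG) cardA.
suffices -> : ~: A = [set z | (z \in A) == false] by lia.
by apply/setP=> z; rewrite !inE eqbF_neg.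
Qed.

Lemma difference_sym : symmetric b.
Proof.
by move=> g h; rewrite /b !cayleyE -mem_lcosetV invMg invgK.
Qed.

Lemma difference_cross g h : b g h -> (g \in A) != (h \in A).
Proof. by rewrite /b cayleyE => /lcoset_notin_cycle; rewrite mem_cycle_div. Qed.

Lemma difference_regular : regular_graph b k.
Proof.
case: diffD => _ _ <- _ _ g; rewrite -(card_lcoset D y) -(card_rcoset (y *: D) g).
by apply: eq_card => z; rewrite inE.
Qed.

(* A common neighbour z = y d1 h = y d2 g amounts to h g^-1 = d1^-1 d2. *)
Lemma difference_common_nbrs g h : g != h -> (g \in A) = (h \in A) ->
  common_nbrs b g h = l.
Proof.
move=> neq_gh eq_side; case: diffD => _ _ _ _ reprD.
have A1u : h * g^-1 \in A^#.
  by rewrite !inE mem_cycle_div eq_side eqxx andbT -eq_mulgV1 eq_sym.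
rewrite -(reprD _ A1u) /common_nbrs.
(* The pair [(d1, d2)] is sent to [z = y * d1 * h]; this is injective because [d1] and the
   represented element determine [d2]. *)
rewrite -(@card_in_imset _ _ (fun d => y * d.1 * h)) => [|[d1 d2] [d1' d2']].
  apply: eq_card => z; rewrite inE /b !cayleyE.
  apply/andP/imsetP => [[/lcosetP[d2 Dd2 zg] /lcosetP[d1 Dd1 zh]] | [[d1 d2]]].
    exists (d1, d2); last by rewrite -zh mulgKV.
    rewrite inE /= Dd1 Dd2 /=; apply/eqP.
    have -> : d1^-1 * d2 = (y * d1)^-1 * (y * d2).
      by rewrite invMg -mulgA mulKg.
    by rewrite -zh -zg invMg invgK mulgA mulgKV.
  rewrite inE /= => /and3P[Dd1 Dd2 /eqP eq_u] ->.
  by rewrite mulgK -mulgA eq_u -mulgA mulKVg !mem_lcoset !mulKg.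
rewrite !inE /= => /and3P[_ _ /eqP-> ] /and3P[_ _ /eqP eq_u].
move=> /mulIg/mulgI eq1; rewrite -{}eq1 in eq_u *.
by rewrite (mulgI _ _ _ eq_u).
Qed.

Lemma difference_adjE g h : cayley (A^# :|: y *: D) g h =
  (g != h) && ((g \in A) == (h \in A)) || b g h.
Proof.
by rewrite /b !cayleyE inE 2!inE mem_cycle_div -eq_mulgV1 eq_sym.
Qed.

Hypothesis parameters : (2 * k + 2 = n + l)%N.
Hypothesis k_ltn : k < n.

Let k_gt0 : 0 < k.
Proof. by case: diffD => _ _ _ l_gt0 _; lia. Qed.

Theorem difference_strictly_deza : strictly_deza (cayley (A^# :|: y *: D)).
Proof.
exact: (clique_design_strictly_deza difference_card_side difference_sym
  difference_cross difference_regular difference_common_nbrs n_gt1 k_gt0 k_ltn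
  difference_adjE parameters).
Qed.

Theorem difference_WL_rank : has_WL_rank (cayley (A^# :|: y *: D)) 4.
Proof.
exact: (clique_design_WL_rank difference_card_side difference_sym
  difference_cross difference_regular difference_common_nbrs n_gt1 k_gt0 k_ltn
  difference_adjE parameters).
Qed.

Lemma difference_dihedrant : dihedrant (cayley (A^# :|: y *: D)).
Proof.
exists n, gT, (A^# :|: y *: D); split=> //; first by case: presG.
  exact: connection_set_lcoset.
by exists id => //; exists id.
Qed.

End DifferenceSets.

(** * Eliminating the square root, and the two families *)

Lemma difference_parameters (n k l : nat) : 2 < n ->
  (k%:R = (2 * n%:R - 1 - sqrtC (8 * n%:R - 7)) / 2 :> algC)%R ->
  (l%:R = n%:R + 1 - sqrtC (8 * n%:R - 7) :> algC)%R ->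
  (2 * k + 2 = n + l)%N /\ k < n.
Proof.
move=> n_gt2 kE lE.
(* In [algC] the sign of the root must be established: [8 * n - 7] is nonnegative. *)
have s_ge0 : (0 <= sqrtC (8 * n%:R - 7) :> algC)%R.
  by rewrite sqrtC_ge0 subr_ge0 -natrM ler_nat; lia.
move: (sqrtC _) s_ge0 kE lE => s s_ge0 kE lE.
have two_neq0 : (2 != 0 :> algC)%R by rewrite pnatr_eq0.
have eq_kl : (2 * k + 2 = n + l)%N.
  apply/eqP; rewrite -(eqr_nat algC) (natrD _ (2 * k)) (natrM _ 2) (natrD _ n l).
  rewrite kE lE mulrC divfK //.
  by apply/eqP; ring.
(* With this bound [2 * k = n + l - 2] is at most [2 * n - 1], so [k < n]. *)
suffices : l <= n + 1 by lia.
by rewrite -(ler_nat algC) lE (natrD _ n 1) gerBl.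
Qed.

(** Equations in [algC] express that the formulas with square roots take the natural values [k] and
    [l], without truncated subtraction or division. *)
Theorem theorem1p1 :
  (forall (n : nat) (gT : finGroupType) (x y : gT),
     3 <= n -> dihedral_presentation n x y ->
     forall (D : {set gT}) (k l : nat),
       (k%:R = (2 * n%:R - 1 - sqrtC (8 * n%:R - 7)) / 2 :> algC)%R ->
       (l%:R = n%:R + 1 - sqrtC (8 * n%:R - 7) :> algC)%R ->
       difference_set <[x]> D n k l ->
       let Gamma := cayley (<[x]>^# :|: y *: D) in
       [/\ strictly_deza Gamma, dihedrant Gamma & has_WL_rank Gamma 4]) /\
  (forall m : nat,
     2 <= m -> ~~ (4 %| m) ->
     let Gamma := cartesian_product (@complete_graph 4) (@complete_graph m) in
     [/\ strictly_deza Gamma, dihedrant Gamma & has_WL_rank Gamma 4]).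
Proof.
split=> [n gT x y n_gt2 presG D k l kE lE diffD | m m_gt1 m_n4] Gamma.
  have [parameters k_ltn] := difference_parameters n_gt2 kE lE.
  split.
  - exact: (difference_strictly_deza n_gt2 presG diffD).
  - exact: (difference_dihedrant n_gt2 presG diffD).
  - exact: (difference_WL_rank n_gt2 presG diffD).
have m_neq4 : m != 4 by apply: contraNneq m_n4 => ->.
split; first exact: rook4_strictly_deza.
  exact: rook4_dihedrant.
by apply: rook_WL_rank; rewrite // eq_sym.
Qed.
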